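(* Let $F(z)$ be an $n\times n$ matrix valued meromorphic function in $\mathbb{C}$ that is holomorphic at $0$ and satisfies $\det F(0)\neq 0$. Then there exist an $n\times n$ matrix valued entire function $P(z)$ of canonical product form and an $n\times n$ matrix valued entire function $G(z)$ such that $$G(z)=P(z)\,F(z).$$
   Context: A matrix valued function is meromorphic (entire) if all its entries are meromorphic (entire). An $n\times n$ matrix valued entire function $P(z)$ is said to be of canonical product form if there are a sequence $\{P_k\}_{k\ge1}$ of $n\times n$ orthogonal projection matrices (the zero matrix is allowed) and a sequence $\{z_k\}_{k\ge 1}$ of nonzero complex numbers with $|z_k|\to\infty$ such that $$P(z)=\lim_{k\to\infty}\exp\Big(\frac{z}{z_k}P_k+\frac12\frac{z^2}{z_k^2}P_k+\cdots+\frac1k\frac{z^k}{z_k^k}P_k\Big)\Big(I_n-\frac{z}{z_k}P_k\Big)\cdots\exp\Big(\frac{z}{z_1}P_1\Big)\Big(I_n-\frac{z}{z_1}P_1\Big),$$ where the $j$-th factor is $\exp\big(\sum_{l=1}^{j}\frac1l\frac{z^l}{z_j^l}P_j\big)\big(I_n-\frac{z}{z_j}P_j\big)$ and factors with larger index stand to the left. The limit is uniform on bounded sets in operator norm. Finite products, and the empty product $I_n$, are included (take $P_k=0$ for the remaining indices). *)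

(* Defs.v *)
From HB Require Import structures.
From mathcomp Require Import all_boot all_order all_algebra.
From mathcomp Require Import complex.
From mathcomp Require Import all_classical all_reals all_analysis.

Set Implicit Arguments.
Unset Strict Implicit.
Unset Printing Implicit Defensive.

Import Order.TTheory GRing.Theory Num.Theory.
Import numFieldNormedType.Exports.

Local Open Scope classical_set_scope.
Local Open Scope ring_scope.
Local Open Scope sesquilinear_scope.

(* [R[i]] carries no topology by itself: the topology and the normed module   *)
(* structure over [R[i]] are those of the convertible alias [R[i]^o].         *)

(* [`|x|] lives in [R[i]]; this is the same modulus as an element of [R]. *)
Definition cabs (R : realType) (x : R[i]) : R := complex.Re `|x|.

(* The scalar field of [derivable] is [R[i]], so this is complex              *)
(* differentiability.                                                         *)
Definition holomorphic_at (R : realType) (f : R[i] -> R[i]) (a : R[i]) : Prop :=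
  \forall z \near (a : R[i]^o), derivable (f : R[i]^o -> R[i]^o) z 1.

Definition entire (R : realType) (f : R[i] -> R[i]) : Prop :=
  forall a, holomorphic_at f a.

Definition pole_at (R : realType) (f : R[i] -> R[i]) (a : R[i]) : Prop :=
  exists (m : nat) (g : R[i] -> R[i]),
    [/\ (0 < m)%N, holomorphic_at g a, g a != 0 &
        \forall z \near (a : R[i]^o)^', f z = g z / (z - a) ^+ m].

(* A meromorphic function is represented by a total function, whose values at *)
(* its poles are arbitrary and carry no information.                          *)
Definition meromorphic (R : realType) (f : R[i] -> R[i]) : Prop :=
  forall a, holomorphic_at f a \/ pole_at f a.

Definition mx_holomorphic_at (R : realType) (n : nat)
    (F : R[i] -> 'M[R[i]]_n) (a : R[i]) : Prop :=
  forall i j, holomorphic_at (fun z => F z i j) a.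

Definition mx_entire (R : realType) (n : nat) (F : R[i] -> 'M[R[i]]_n) : Prop :=
  forall i j, entire (fun z => F z i j).

Definition mx_meromorphic (R : realType) (n : nat)
    (F : R[i] -> 'M[R[i]]_n) : Prop :=
  forall i j, meromorphic (fun z => F z i j).

Definition orthogonal_projection (R : realType) (n : nat)
    (Q : 'M[R[i]]_n) : Prop :=
  Q *m Q = Q /\ Q ^t* = Q.

Definition mx_exp (R : realType) (n : nat) (A : 'M[R[i]]_n) : 'M[R[i]]_n :=
  limn (fun N => \sum_(0 <= k < N) (k`!%:R)^-1 *: A ^+ k : 'M[R[i]^o]_n).

Definition vec_norm (R : realType) (n : nat) (x : 'cV[R[i]]_n) : R :=
  Num.sqrt (\sum_i cabs (x i 0) ^+ 2).

Definition op_norm (R : realType) (n : nat) (A : 'M[R[i]]_n) : R :=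
  sup [set vec_norm (A *m x) | x in [set x : 'cV[R[i]]_n | vec_norm x <= 1]].

Definition canonical_factor (R : realType) (n j : nat) (Q : 'M[R[i]]_n)
    (a z : R[i]) : 'M[R[i]]_n :=
  mx_exp (\sum_(1 <= l < j.+1) (l%:R^-1 * (z ^+ l / a ^+ l)) *: Q)
    *m (1%:M - (z / a) *: Q).

(* The sequences are indexed from 1: [Q 0] and [a 0] are never used. *)
Fixpoint canonical_partial_product (R : realType) (n : nat)
    (Q : nat -> 'M[R[i]]_n) (a : nat -> R[i]) (k : nat) (z : R[i]) :
    'M[R[i]]_n :=
  if k is j.+1 then
    canonical_factor k (Q k) (a k) z *m canonical_partial_product Q a j z
  else 1%:M.

Definition canonical_product_form (R : realType) (n : nat)
    (P : R[i] -> 'M[R[i]]_n) : Prop :=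
  mx_entire P /\
  exists (Q : nat -> 'M[R[i]]_n) (a : nat -> R[i]),
    [/\ forall k, (1 <= k)%N -> orthogonal_projection (Q k),
        forall k, (1 <= k)%N -> a k != 0,
        cabs (a k) @[k --> \oo] --> +oo &
        forall B : set R[i]^o, bounded_set B -> forall e : R, 0 < e ->
          \forall k \near \oo, forall z, B z ->
            op_norm (P z - canonical_partial_product Q a k z) < e].

(* Main.v *)
Require Import Defs.
From mathcomp Require Import all_boot all_order all_algebra.
From mathcomp Require Import complex.
From mathcomp Require Import all_classical all_reals all_analysis.
From mathcomp Require Import ring lra.

(* Every projection of the canonical product can be taken to be the identity  *)
(* matrix, so that [P = f I_n] for a scalar Weierstrass product [f] which     *)
(* vanishes, at each pole of [F], at least to the order of that pole. The     *)
(* elementary factor satisfies [1 - E_k(u) = sum_(j > k) c_j u ^ j] with      *)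
(* [c_j >= 0] and [sum_j c_j = 1], hence [E_k - 1] and its Lipschitz constant *)
(* are [O(2 ^ - k)] on [|u| <= 1 / 4]. Convergence is measured by sup norm    *)
(* and Lipschitz constant together: a limit of entire functions in this sense *)
(* is entire because its difference quotients are Cauchy, which avoids        *)
(* Cauchy's integral formula.                                                 *)

Set Implicit Arguments.
Unset Strict Implicit.
Unset Printing Implicit Defensive.

Import Order.TTheory GRing.Theory Num.Theory.
Import numFieldNormedType.Exports.

Local Open Scope classical_set_scope.
Local Open Scope complex_scope.
Local Open Scope ring_scope.

Section Modulus.
Variable R : realType.
Implicit Types (x y z a : R[i]) (r : R).

Lemma cabsE x : `|x| = (cabs x)%:C.
Proof. by rewrite /cabs normc_def. Qed.

Lemma cabs_ge0 x : 0 <= cabs x.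
Proof. by rewrite -lecR -cabsE; exact: normr_ge0. Qed.

Lemma cabs_eq0 x : (cabs x == 0) = (x == 0).
Proof. by rewrite -[RHS]normr_eq0 cabsE -(inj_eq (@complexI R)). Qed.

Lemma cabs0 : cabs (0 : R[i]) = 0.
Proof. by apply/eqP; rewrite cabs_eq0. Qed.

Lemma cabs_gt0 x : (0 < cabs x) = (x != 0).
Proof. by rewrite lt_def cabs_ge0 andbT cabs_eq0. Qed.

Lemma cabsM x y : cabs (x * y) = cabs x * cabs y.
Proof. by apply: complexI; rewrite rmorphM /= -!cabsE normrM. Qed.

Lemma cabsX x k : cabs (x ^+ k) = cabs x ^+ k.
Proof. by apply: complexI; rewrite rmorphXn /= -!cabsE normrX. Qed.

Lemma cabsV x : cabs x^-1 = (cabs x)^-1.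
Proof. by apply: complexI; rewrite fmorphV /= -!cabsE normfV. Qed.

Lemma cabsN x : cabs (- x) = cabs x.
Proof. by apply: complexI; rewrite -!cabsE normrN. Qed.

Lemma cabsB x y : cabs (x - y) = cabs (y - x).
Proof. by rewrite -cabsN opprB. Qed.

Lemma ler_cabsD x y : cabs (x + y) <= cabs x + cabs y.
Proof. by rewrite -lecR rmorphD /= -!cabsE ler_normD. Qed.

Lemma ler_cabsB x y : cabs (x - y) <= cabs x + cabs y.
Proof. by rewrite -(cabsN y) ler_cabsD. Qed.

Lemma cabs_real r : cabs r%:C = `|r|.
Proof. by rewrite /cabs normc_def /= expr0n addr0 sqrtr_sqr. Qed.

Lemma real_complex_nat k : (k%:R : R)%:C = k%:R.
Proof. by rewrite rmorph_nat. Qed.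

Lemma cabs_nat k : cabs (k%:R : R[i]) = k%:R.
Proof. by rewrite -real_complex_nat cabs_real ger0_norm. Qed.

Lemma ler_cabs_sum (I : Type) (s : seq I) (P : pred I) (f : I -> R[i]) :
  cabs (\sum_(i <- s | P i) f i) <= \sum_(i <- s | P i) cabs (f i).
Proof.
elim/big_ind2: _ => [|x r y r' le_x le_y|//]; first by rewrite cabs0.
by rewrite (le_trans (ler_cabsD _ _)) // lerD.
Qed.

Lemma Re_le_cabs x : `|complex.Re x| <= cabs x.
Proof. by rewrite -lecR -cabsE normc_ge_Re. Qed.

Lemma Im_le_cabs x : `|complex.Im x| <= cabs x.
Proof.
by rewrite /cabs normc_def /= -sqrtr_sqr ler_wsqrtr // lerDr sqr_ge0.
Qed.

Lemma cabs_le_ReIm x : cabs x <= `|complex.Re x| + `|complex.Im x|.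
Proof.
rewrite /cabs normc_def /= -[leRHS]ger0_norm ?addr_ge0 // -sqrtr_sqr.
rewrite ler_wsqrtr // sqrrD !real_normK ?num_real // lerD2r lerDl.
by rewrite mulrn_wge0 // mulr_ge0.
Qed.

Lemma gt0_real_complex (e : R[i]) : 0 < e -> exists2 r : R, 0 < r & e = r%:C.
Proof.
move=> e0; have /complex_realP[r er] : e \is Num.real by exact: gtr0_real.
by exists r => //; rewrite -ltcR -er.
Qed.

Lemma nbhs_cabsP a (A : set R[i]) :
  (\forall z \near (a : R[i]^o), A z) <->
  exists2 d : R, 0 < d & forall z, cabs (z - a) < d -> A z.
Proof.
split=> [/nbhs_ballP[e /= /gt0_real_complex[r r0 ->] sub]|[d d0 sub]].
  exists r => // z zd; apply: sub; rewrite -ball_normE /= distrC.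
  by rewrite cabsE ltcR.
apply/nbhs_ballP; exists d%:C; rewrite /= ?ltcR // => z.
by rewrite -ball_normE /= distrC cabsE ltcR; exact: sub.
Qed.

Lemma dnbhs_cabsP a (A : set R[i]) :
  (\forall z \near (a : R[i]^o)^', A z) <->
  exists2 d : R, 0 < d & forall z, z != a -> cabs (z - a) < d -> A z.
Proof.
have := nbhs_cabsP a (fun z => z != a -> A z); rewrite /dnbhs /within /= => E.
by apply: iff_trans E _; split=> -[d d0 sub]; exists d => // z ? ?; exact: sub.
Qed.

Lemma cvg_cabsP (T : Type) (F : set_system T) (f : T -> R[i]) a :
  Filter F ->
  (f x @[x --> F] --> (a : R[i]^o)) <->
  forall e : R, 0 < e -> \forall x \near F, cabs (f x - a) < e.
Proof.
move=> FF; split=> [fa e e0|fa].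
  by apply: (fa [set y | cabs (y - a) < e]); apply/nbhs_cabsP; exists e.
by move=> A /nbhs_cabsP[d d0 sub]; apply: filterS (fa _ d0) => x /sub.
Qed.

Lemma cvg_cabsMl (u : nat -> R[i]) a c : u k @[k --> \oo] --> (a : R[i]^o) ->
  (c * u k) @[k --> \oo] --> (c * a : R[i]^o).
Proof.
move=> ua; apply/cvg_cabsP => e e0.
have c1 : 0 < cabs c + 1 by rewrite ltr_wpDl ?cabs_ge0.
have /cvg_cabsP/(_ _ (divr_gt0 e0 c1)) := ua; apply: filterS => k uk.
rewrite -mulrBr cabsM (le_lt_trans (ler_wpM2l (cabs_ge0 _) (ltW uk))) //.
by rewrite mulrCA gtr_pMr // ltr_pdivrMr ?mul1r ?ltrDl.
Qed.

Lemma complex_cauchy_cvg (T : Type) (F : set_system T) (f : T -> R[i]) :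
  ProperFilter F ->
  (forall e : R, 0 < e -> exists b, \forall x \near F, cabs (f x - b) < e) ->
  exists a, f x @[x --> F] --> (a : R[i]^o).
Proof.
move=> FF fC.
have part (p : R[i] -> R) : {morph p : x y / x - y} ->
    (forall x, `|p x| <= cabs x) -> cvg (p (f x) @[x --> F]).
  move=> pB ple; apply/cauchy_cvgP; apply: cauchy_exP => e e0.
  have [b near_b] := fC e e0; exists (p b).
  rewrite /nbhs /=; apply: filterS near_b => x; rewrite /ball /= -pB cabsB.
  exact: le_lt_trans.
have /cvg_ex[/= u fu] := part (@complex.Re R)
  (fun x y => raddfB (@complex.Re R) x y) Re_le_cabs.
have /cvg_ex[/= v fv] := part (@complex.Im R)
  (fun x y => raddfB (@complex.Im R) x y) Im_le_cabs.
exists (u +i* v); apply/cvg_cabsP => e e0.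
have e20 : 0 < e / 2 by rewrite divr_gt0.
move/cvgrPdist_lt: fu => /(_ _ e20); move/cvgrPdist_lt: fv => /(_ _ e20).
apply: filterS2 => x fv fu; apply: le_lt_trans (cabs_le_ReIm _) _.
rewrite (splitr e) ltrD //.
  by rewrite distrC (raddfB (@complex.Re R)) in fu *.
by rewrite distrC (raddfB (@complex.Im R)) in fv *.
Qed.

End Modulus.

Section Entire.
Variable R : realType.
Implicit Types (f g : R[i] -> R[i]) (a z w : R[i]) (r e L : R).

Lemma derivable_approx f a :
  (forall e, 0 < e -> exists g, derivable (g : R[i]^o -> R[i]^o) a 1 /\
    exists2 d : R, 0 < d & forall z, cabs (z - a) < d ->
      cabs (f z - g z - (f a - g a)) <= e * cabs (z - a)) ->
  derivable (f : R[i]^o -> R[i]^o) a 1.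
Proof.
move=> approx; apply/cvg_ex; apply: complex_cauchy_cvg => e e0.
have e20 : 0 < e / 2 by rewrite divr_gt0.
have [g [/cvg_ex[/= b gb] [d d0 fg]]] := approx _ e20; exists b.
have /cvg_cabsP/(_ _ e20) nearb := gb.
have near0 : \forall h \near (0 : R[i]^o)^', h != 0 /\ cabs h < d.
  by apply/dnbhs_cabsP; exists d => // z z0; rewrite subr0.
apply: filterS2 near0 nearb => h [h0 hd] /=; rewrite /GRing.scale /= mulr1 => gh.
have {}fg := fg (h + a); rewrite addrK in fg.
rewrite (_ : _ - b = (h^-1 * (g (h + a) - g a) - b)
  + h^-1 * (f (h + a) - g (h + a) - (f a - g a))); last by ring.
rewrite (splitr e) (le_lt_trans (ler_cabsD _ _)) // ltr_leD //.
by rewrite cabsM cabsV ler_pdivrMl ?cabs_gt0 // mulrC fg.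
Qed.

Lemma entireP f :
  entire f <-> forall a, derivable (f : R[i]^o -> R[i]^o) a 1.
Proof.
split=> [fe a|fd a]; first exact: nbhs_singleton (fe a).
by apply/nbhs_cabsP; exists 1.
Qed.

Lemma holomorphic_atM f g a : holomorphic_at f a -> holomorphic_at g a ->
  holomorphic_at (fun z => f z * g z) a.
Proof.
move=> /nbhs_cabsP[d d0 fd] /nbhs_cabsP[d' d'0 gd]; apply/nbhs_cabsP.
exists (Num.min d d'); first by rewrite lt_min d0.
by move=> z; rewrite lt_min => /andP[zd zd']; exact: derivableM (fd z zd) (gd z zd').
Qed.

Lemma entire_cst a : entire (fun=> a).
Proof. by apply/entireP => z; exact: derivable_cst. Qed.

Lemma entire_id : entire (fun z => z).
Proof. by apply/entireP => z; exact: derivable_id. Qed.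

Lemma entireD f g : entire f -> entire g -> entire (fun z => f z + g z).
Proof.
move=> /entireP fe /entireP ge; apply/entireP => a.
exact: derivableD (fe a) (ge a).
Qed.

Lemma entireM f g : entire f -> entire g -> entire (fun z => f z * g z).
Proof. by move=> fe ge a; exact: holomorphic_atM. Qed.

Lemma entireX f k : entire f -> entire (fun z => f z ^+ k).
Proof.
move=> fe; elim: k => [|k IHk].
  have -> : (fun z => f z ^+ 0) = fun=> 1 by apply/funext => z; rewrite expr0.
  exact: (entire_cst 1).
have -> : (fun z => f z ^+ k.+1) = fun z => f z * f z ^+ k.
  by apply/funext => z; rewrite exprS.
exact: entireM.
Qed.

Lemma entire_sum (I : Type) (s : seq I) (f : I -> R[i] -> R[i]) :
  (forall i, entire (f i)) -> entire (fun z => \sum_(i <- s) f i z).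
Proof.
move=> fe; elim: s => [|i s IHs].
  have -> : (fun z => \sum_(i <- [::]) f i z) = fun=> 0.
    by apply/funext => z; rewrite big_nil.
  exact: (entire_cst 0).
have -> : (fun z => \sum_(j <- i :: s) f j z) =
    fun z => f i z + \sum_(j <- s) f j z.
  by apply/funext => z; rewrite big_cons.
exact: (entireD (fe i) IHs).
Qed.

Lemma entire_comp f g : entire f -> entire g -> entire (f \o g).
Proof.
move=> /entireP fe /entireP ge; apply/entireP => a; apply/derivable1_diffP.
have /derivable1_diffP gd := ge a; have /derivable1_diffP fd := fe (g a).
exact: (differentiable_comp gd fd).
Qed.

Definition c1_bound f r L := forall z w, cabs z <= r -> cabs w <= r ->
  cabs (f z) <= L /\ cabs (f z - f w) <= L * cabs (z - w).

Lemma c1_bound_ext f g r L : c1_bound f r L ->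
  (forall z, cabs z <= r -> f z = g z) -> c1_bound g r L.
Proof. by move=> fb fg z w zr wr; rewrite -!fg //; exact: fb. Qed.

Lemma c1_bound_le f r r' L L' : r' <= r -> L <= L' ->
  c1_bound f r L -> c1_bound f r' L'.
Proof.
move=> r'r LL' fb z w zr wr.
have [fz fzw] := fb _ _ (le_trans zr r'r) (le_trans wr r'r).
by rewrite (le_trans fz) // (le_trans fzw) // ler_wpM2r // cabs_ge0.
Qed.

Lemma c1_bound_cst a r : c1_bound (fun=> a) r (cabs a).
Proof. by move=> z w _ _; rewrite subrr cabs0 mulr_ge0 ?cabs_ge0. Qed.

Lemma c1_bound_id r : c1_bound (fun z => z) r (Num.max 1 r).
Proof.
move=> z w zr _; rewrite le_max zr orbT; split=> //.
by rewrite ler_peMl ?cabs_ge0 // le_max lexx.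
Qed.

Lemma c1_boundD f g r L L' : c1_bound f r L -> c1_bound g r L' ->
  c1_bound (fun z => f z + g z) r (L + L').
Proof.
move=> fb gb z w zr wr; have [fz fzw] := fb _ _ zr wr.
have [gz gzw] := gb _ _ zr wr; split.
  by rewrite (le_trans (ler_cabsD _ _)) // lerD.
by rewrite opprD addrACA (le_trans (ler_cabsD _ _)) // mulrDl lerD.
Qed.

Lemma c1_boundN f r L : c1_bound f r L -> c1_bound (fun z => - f z) r L.
Proof.
by move=> fb z w zr wr; rewrite -opprD !cabsN; exact: fb.
Qed.

Lemma c1_boundM f g r L L' : c1_bound f r L -> c1_bound g r L' ->
  c1_bound (fun z => f z * g z) r (2 * L * L').
Proof.
move=> fb gb z w zr wr; have [fz fzw] := fb _ _ zr wr.
have [gz gzw] := gb _ _ zr wr; have [gw _] := gb _ _ wr zr.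
have L0 := le_trans (cabs_ge0 _) fz.
have L'0 := le_trans (cabs_ge0 _) gz.
split.
  rewrite cabsM (le_trans (ler_pM _ _ fz gz)) ?cabs_ge0 //.
  by rewrite ler_wpM2r // ler_peMl // ler1n.
rewrite (_ : _ - _ = f z * (g z - g w) + (f z - f w) * g w); last by ring.
apply: le_trans (ler_cabsD _ _) _; rewrite !cabsM.
rewrite (_ : _ * cabs (z - w) = L * (L' * cabs (z - w)) + L * cabs (z - w) * L').
  by rewrite lerD // ler_pM ?cabs_ge0.
ring.
Qed.

Lemma c1_bound_comp f g r r' L L' : c1_bound g r L' -> L' <= r' ->
  c1_bound f r' L -> c1_bound (f \o g) r (L * Num.max 1 L').
Proof.
move=> gb L'r fb z w zr wr /=.
have [gz gzw] := gb _ _ zr wr; have [gw _] := gb _ _ wr zr.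
have [fz fzw] := fb _ _ (le_trans gz L'r) (le_trans gw L'r).
have L0 := le_trans (cabs_ge0 _) fz.
split; first by rewrite (le_trans fz) // ler_peMr // le_max lexx.
rewrite (le_trans fzw) // -mulrA ler_wpM2l // (le_trans gzw) //.
by rewrite ler_wpM2r ?cabs_ge0 // le_max lexx orbT.
Qed.

Lemma c1_bound_lim (u : nat -> R[i] -> R[i]) f r L :
  (forall z, u k z @[k --> \oo] --> (f z : R[i]^o)) ->
  (\forall k \near \oo, c1_bound (u k) r L) -> c1_bound f r L.
Proof.
move=> uf ub z w zr wr; split; apply/ler_addgt0Pl => e e0.
  have /cvg_cabsP/(_ _ e0) near_z := uf z.
  have [k [uz ubk]] := filter_ex (filterI near_z ub).
  have [uzL _] := ubk _ _ zr wr.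
  rewrite -(subrK (u k z) (f z)) (le_trans (ler_cabsD _ _)) // lerD //.
  by rewrite cabsB ltW.
have e20 : 0 < e / 2 by rewrite divr_gt0.
have /cvg_cabsP/(_ _ e20) near_z := uf z.
have /cvg_cabsP/(_ _ e20) near_w := uf w.
have [k [[uz uw] ubk]] := filter_ex (filterI (filterI near_z near_w) ub).
have [_ uL] := ubk _ _ zr wr.
rewrite (_ : f z - f w = (u k w - f w) - (u k z - f z) + (u k z - u k w)).
  rewrite (le_trans (ler_cabsD _ _)) // lerD // (le_trans (ler_cabsB _ _)) //.
  by rewrite (splitr e) lerD // ltW.
ring.
Qed.

Lemma entire_c1_lim (u : nat -> R[i] -> R[i]) f : (forall k, entire (u k)) ->
  (forall r e, 0 < e -> exists k, c1_bound (fun z => f z - u k z) r e) ->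
  entire f.
Proof.
move=> ue uf; apply/entireP => a; apply: derivable_approx => e e0.
have [k fk] := uf (cabs a + 1) e e0; exists (u k); split.
  by move/entireP: (ue k); exact.
exists 1 => // z za; have [] // := fk z a.
  by rewrite -(subrKC a z) (le_trans (ler_cabsD _ _)) // lerD2l ltW.
by rewrite lerDl.
Qed.

Lemma c1_cauchy_lim (u : nat -> R[i] -> R[i]) :
  (forall r e, 0 < e -> exists N, forall M, (N <= M)%N ->
    c1_bound (fun z => u M z - u N z) r e) ->
  exists f, (forall z, u k z @[k --> \oo] --> (f z : R[i]^o)) /\
    forall r e, 0 < e -> exists N, forall M, (N <= M)%N ->
      c1_bound (fun z => f z - u M z) r e.
Proof.
move=> uC.
have /choice[f uf] : forall z, exists b, u k z @[k --> \oo] --> (b : R[i]^o).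
  move=> z; apply: complex_cauchy_cvg => e e0.
  have e20 : 0 < e / 2 by rewrite divr_gt0.
  have [N uN] := uC (cabs z) _ e20; exists (u N z).
  exists N => // M NM; have [uMN _] := uN M NM z z (lexx _) (lexx _).
  by rewrite (le_lt_trans uMN) // ltr_pdivrMr // ltr_pMr // ltr1n.
exists f; split=> // r e e0; have e20 : 0 < e / 2 by rewrite divr_gt0.
have [N uN] := uC r _ e20; exists N => M NM.
have fN : c1_bound (fun z => f z - u N z) r (e / 2).
  apply: (@c1_bound_lim (fun k z => u k z - u N z)); last by exists N.
  move=> z; apply/cvg_cabsP => d d0; have /cvg_cabsP/(_ _ d0) := uf z.
  by apply: filterS => k; rewrite opprB addrA subrK.
rewrite (splitr e); apply: c1_bound_ext (c1_boundD fN (c1_boundN (uN M NM))) _.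
by move=> z _; rewrite opprB addrA subrK.
Qed.

End Entire.

Section Exponential.
Variable R : realType.
Implicit Types (p q : {poly R}) (z w c u : R[i]) (r e L : R) (k N M : nat).

Local Notation toC p := (map_poly (real_complex R) p).
Local Notation nneg_poly := (polyOver (@Num.Def.nneg_num_pred R)).

Lemma horner_deriv p r :
  p^`().[r] = \sum_(i < size p) p`_i * (i%:R * r ^+ i.-1).
Proof.
have -> : p^`().[r] = \sum_(i < (size p).-1) p`_i.+1 *+ i.+1 * r ^+ i.
  rewrite (horner_coef_wide _ (size_poly _ _)).
  by apply: eq_bigr => i _; rewrite coef_deriv.
case: (size p) => [|m]; first by rewrite !big_ord0.
rewrite [RHS]big_ord_recl /= mul0r mulr0 add0r; apply: eq_bigr => i _.
by rewrite /bump /= add1n mulrA mulr_natr.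
Qed.

Lemma c1_bound_poly p r : p \is a nneg_poly -> 0 <= r ->
  c1_bound (fun z => (toC p).[z]) r (p.[r] + p^`().[r]).
Proof.
move=> /polyOverP p0 r0; have {}p0 i : 0 <= p`_i := p0 i.
have toCE z : (toC p).[z] = \sum_(i < size p) (p`_i)%:C * z ^+ i.
  rewrite horner_coef size_map_inj_poly ?rmorph0 //; last exact: complexI.
  by apply: eq_bigr => i _; rewrite coef_map.
have p'E := horner_deriv p r.
have p'0 : 0 <= p^`().[r].
  by rewrite p'E sumr_ge0 // => i _; rewrite !mulr_ge0 // exprn_ge0.
have p00 : 0 <= p.[r].
  by rewrite horner_coef sumr_ge0 // => i _; rewrite mulr_ge0 // exprn_ge0.
move=> z w zr wr; split.
  apply: (@le_trans _ _ p.[r]); last by rewrite lerDl.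
  rewrite toCE horner_coef (le_trans (ler_cabs_sum _ _ _)) // ler_sum // => i _.
  rewrite cabsM cabs_real ger0_norm // cabsX ler_wpM2l //.
  by rewrite lerXn2r ?nnegrE // cabs_ge0.
apply: (@le_trans _ _ (p^`().[r] * cabs (z - w))); last first.
  by rewrite ler_wpM2r ?cabs_ge0 // lerDr.
rewrite !toCE -sumrB p'E mulr_suml (le_trans (ler_cabs_sum _ _ _)) //.
apply: ler_sum => i _; rewrite -mulrBr cabsM cabs_real ger0_norm // -mulrA.
rewrite ler_wpM2l // subrXX cabsM mulrC ler_wpM2r ?cabs_ge0 //.
rewrite (le_trans (ler_cabs_sum _ _ _)) //.
rewrite (_ : i%:R * _ = \sum_(j < i) r ^+ i.-1); last first.
  by rewrite sumr_const card_ord mulr_natl.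
apply: ler_sum => j _; rewrite cabsM !cabsX.
have -> : i.-1 = ((i.-1 - j) + j)%N.
  by rewrite subnK // -ltnS (ltn_predK (leq_ltn_trans (leq0n _) (ltn_ord j))).
by rewrite addnK exprD ler_pM ?exprn_ge0 ?cabs_ge0 // lerXn2r ?nnegrE // cabs_ge0.
Qed.

Definition exp_poly N : {poly R} := \sum_(0 <= j < N) (j`!%:R)^-1 *: 'X^j.

Lemma exp_poly_nneg N : exp_poly N \is a nneg_poly.
Proof.
apply: rpred_sum => j _; apply: polyOverZ; last exact: polyOverXn.
by rewrite unfold_in /= invr_ge0.
Qed.

Lemma exp_polyB_nneg N M : (N <= M)%N -> exp_poly M - exp_poly N \is a nneg_poly.
Proof.
move=> NM; rewrite /exp_poly (big_cat_nat _ NM) //= addrAC subrr add0r.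
apply: rpred_sum => j _; apply: polyOverZ; last exact: polyOverXn.
by rewrite unfold_in /= invr_ge0.
Qed.

Lemma exp_polyS N : exp_poly N.+1 = exp_poly N + (N`!%:R)^-1 *: 'X^N.
Proof. by rewrite /exp_poly big_nat_recr. Qed.

Lemma deriv_exp_polyS N : (exp_poly N.+1)^`() = exp_poly N.
Proof.
rewrite /exp_poly big_nat_recl //= derivD derivZ derivXn scaler0 add0r raddf_sum.
apply: eq_bigr => j _; rewrite /= derivZ derivXn /= -[_ *+ j.+1]scaler_nat scalerA.
congr (_ *: _); rewrite factS natrM invfM mulrAC mulVf ?mul1r ?pnatr_eq0 //.
Qed.

Lemma exp_polyE N r : (exp_poly N).[r] = series (exp_coeff r) N.
Proof.
rewrite /series /exp_poly horner_sum; apply: eq_bigr => j _.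
by rewrite hornerZ hornerXn mulrC.
Qed.

Lemma exp_poly_cauchy r e : 0 < e -> exists N, forall M, (N <= M)%N ->
  c1_bound (fun z => (toC (exp_poly M)).[z] - (toC (exp_poly N)).[z]) r e.
Proof.
move=> e0; have e40 : 0 < e / 4 by rewrite divr_gt0.
have /cvg_ex[/= l lE] := is_cvg_series_exp_coeff `|r|.
have /cvgrPdist_lt/(_ _ e40)[N _ near_l] := lE.
have diff M K : (N <= M)%N -> (N <= K)%N ->
    (exp_poly M - exp_poly K).[`|r|] <= e / 2.
  move=> NM NK; rewrite hornerD hornerN !exp_polyE (le_trans (ler_norm _)) //.
  rewrite -(subrKA l) (le_trans (ler_normD _ _)) //.
  rewrite (_ : e / 2 = e / 4 + e / 4); last by field.
  by apply: lerD; apply: ltW; [rewrite distrC|]; exact: near_l.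
exists N.+1 => M NM.
apply: (c1_bound_ext (f := fun z => (toC (exp_poly M - exp_poly N.+1)).[z])).
  apply: c1_bound_le (c1_bound_poly (exp_polyB_nneg NM) (normr_ge0 r)).
    exact: ler_norm.
  rewrite (splitr e) lerD ?diff ?leqnSn // 1?ltnW //.
  by case: M NM => // M NM; rewrite derivD derivN !deriv_exp_polyS diff.
by move=> z _; rewrite rmorphB hornerD hornerN.
Qed.

Definition cexp c : R[i] :=
  lim ((fun N => (toC (exp_poly N)).[c] : R[i]^o) @ \oo).

Lemma cexp_limit :
  (forall c, (toC (exp_poly N)).[c] @[N --> \oo] --> (cexp c : R[i]^o)) /\
  forall r e, 0 < e -> exists N, forall M, (N <= M)%N ->
    c1_bound (fun z => cexp z - (toC (exp_poly M)).[z]) r e.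
Proof.
have [f [ef fe]] := c1_cauchy_lim exp_poly_cauchy.
suff -> : cexp = f by [].
by apply/funext => c; rewrite /cexp (cvg_lim (@norm_hausdorff _ R[i]^o) (ef c)).
Qed.

Lemma cexp_approx r e : 0 < e -> exists N,
  c1_bound (fun z => cexp z - (toC (exp_poly N)).[z]) r e.
Proof. by move=> /(cexp_limit.2 r)[N eN]; exists N; exact: eN. Qed.

Lemma entire_horner (p : {poly R[i]}) : entire (fun z => p.[z]).
Proof.
have -> : (fun z => p.[z]) = fun z => \sum_(i < size p) p`_i * z ^+ i.
  by apply/funext => z; rewrite horner_coef.
have pe i : entire (fun z => p`_i * z ^+ i).
  exact: (entireM (entire_cst p`_i) (entireX i (@entire_id R))).
exact: (entire_sum (index_enum 'I_(size p)) pe).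
Qed.

Lemma entire_cexp : entire cexp.
Proof.
apply: entire_c1_lim (fun N => @entire_horner (toC (exp_poly N))) _.
exact: cexp_approx.
Qed.

Lemma c1_bound_cexp r : exists L, c1_bound cexp r L.
Proof.
have [N cN] := cexp_approx r ltr01; eexists.
apply: c1_bound_ext (fun z _ => subrK (toC (exp_poly N)).[z] (cexp z)).
apply: (c1_boundD cN); apply: (c1_bound_le (ler_norm r) (lexx _)).
exact: (c1_bound_poly (exp_poly_nneg N)).
Qed.

End Exponential.

Section ElementaryFactor.
Variable R : realType.
Implicit Types (p q : {poly R}) (z w c u a : R[i]) (r e L : R) (k N M : nat).

Local Notation toC p := (map_poly (real_complex R) p).
Local Notation nneg_poly := (polyOver (@Num.Def.nneg_num_pred R)).

Definition log_poly k : {poly R} := \sum_(1 <= l < k.+1) l%:R^-1 *: 'X^l.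

Lemma log_poly_nneg k : log_poly k \is a nneg_poly.
Proof.
apply: rpred_sum => j _; apply: polyOverZ; last exact: polyOverXn.
by rewrite unfold_in /= invr_ge0.
Qed.

Lemma log_poly_factor k : exists2 q, q \is a nneg_poly & log_poly k = 'X * q.
Proof.
exists (\sum_(1 <= l < k.+1) l%:R^-1 *: 'X^(l.-1)).
  apply: rpred_sum => j _; apply: polyOverZ; last exact: polyOverXn.
  by rewrite unfold_in /= invr_ge0.
rewrite mulr_sumr /log_poly !big_nat; apply: eq_bigr => l /andP[l0 _].
by rewrite -scalerAr -exprS prednK.
Qed.

Lemma deriv_log_poly k : (1 - 'X) * (log_poly k)^`() = 1 - 'X^k.
Proof.
elim: k => [|k IHk].
  by rewrite /log_poly big_geq // deriv0 mulr0 expr0 subrr.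
rewrite /log_poly big_nat_recr //= derivD mulrDr IHk derivZ derivXn /=.
rewrite -['X^k *+ _]scaler_nat scalerA mulVf ?pnatr_eq0 // scale1r.
by rewrite exprS; ring.
Qed.

(* This polynomial vanishes at [0], takes the value [1] at [1], and has a     *)
(* derivative with nonnegative coefficients which, for [k <= N], vanishes to  *)
(* order [k] at [0].                                                          *)
Definition elem_poly k N : {poly R} :=
  1 - (1 - 'X) * (exp_poly R N.+1 \Po log_poly k).

Lemma deriv_elem_poly k N : (elem_poly k N)^`() =
  (N`!%:R)^-1 *: log_poly k ^+ N + 'X^k * (exp_poly R N \Po log_poly k).
Proof.
have deriv1 : (1 : {poly R})^`() = 0 by rewrite -polyC1 derivC.
rewrite /elem_poly derivB derivM derivB deriv1 derivX sub0r deriv_comp.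
rewrite deriv_exp_polyS [(_ \Po _) * _]mulrC mulrA deriv_log_poly.
rewrite exp_polyS comp_polyD comp_polyZ comp_Xn_poly.
ring.
Qed.

Lemma elem_poly_coef k N : (k <= N)%N ->
  (forall j, 0 <= (elem_poly k N)`_j) /\
  (forall j, (j <= k)%N -> (elem_poly k N)`_j = 0).
Proof.
move=> kN.
have e_nneg : exp_poly R N \Po log_poly k \is a nneg_poly.
  exact: polyOver_comp (exp_poly_nneg R N) (log_poly_nneg k).
have coefS j : (elem_poly k N)`_j.+1 *+ j.+1 = (elem_poly k N)^`()`_j.
  by rewrite coef_deriv.
have coef0 : (elem_poly k N)`_0 = 0.
  have [q _ pq] := log_poly_factor k.
  rewrite -horner_coef0 /elem_poly !hornerE horner_comp pq !hornerE.
  by rewrite exp_polyE series_exp_coeff0 subr0 mulr1 subrr.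
split=> -[|j].
- by rewrite coef0.
- rewrite -(pmulrn_lge0 _ (ltn0Sn j)) coefS deriv_elem_poly.
  suff /polyOverP/(_ j) : (N`!%:R)^-1 *: log_poly k ^+ N +
    'X^k * (exp_poly R N \Po log_poly k) \is a nneg_poly by [].
  apply: rpredD; last by rewrite rpredM // polyOverXn.
  by apply: polyOverZ; rewrite ?rpredX ?log_poly_nneg // unfold_in /= invr_ge0.
- by rewrite coef0.
move=> jk; apply/eqP.
suff : (elem_poly k N)`_j.+1 *+ j.+1 == 0 by rewrite mulrn_eq0.
rewrite coefS deriv_elem_poly; apply/eqP.
have [q _ ->] := log_poly_factor k.
by rewrite coefD coefZ exprMn !coefXnM (leq_trans jk) // jk mulr0 addr0.
Qed.

Lemma elem_poly_bound k N : (k <= N)%N ->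
  c1_bound (fun u => (toC (elem_poly k N)).[u]) 4^-1 (2 * 2^-1 ^+ k).
Proof.
move=> kN; have [c0 ck] := elem_poly_coef kN.
have sum1 : \sum_(i < size (elem_poly k N)) (elem_poly k N)`_i = 1.
  transitivity (elem_poly k N).[1].
    by rewrite horner_coef; apply: eq_bigr => i _; rewrite expr1n mulr1.
  by rewrite /elem_poly !hornerE subrr mul0r subr0.
have le_half i : (k < i)%N -> 4^-1 ^+ i <= 2^-1 ^+ k :> R.
  move=> ki; apply: (@le_trans _ _ (2^-1 ^+ i)).
    by rewrite lerXn2r ?nnegrE ?invr_ge0 // lef_pV2 ?posrE // ler_nat.
  by rewrite ler_wiXn2l ?invr_ge0 ?invf_le1 ?ler1n // ltnW.
have le_deriv i : (k < i)%N -> i%:R * 4^-1 ^+ i.-1 <= 2^-1 ^+ k :> R.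
  case: i => // i ki; apply: (@le_trans _ _ (2^-1 ^+ i)); last first.
    by rewrite ler_wiXn2l ?invr_ge0 ?invf_le1 ?ler1n.
  rewrite /= (_ : 4^-1 = 2^-1 * 2^-1 :> R); last by field.
  rewrite exprMn mulrA ler_piMl ?exprn_ge0 ?invr_ge0 //.
  rewrite exprVn ler_pdivrMr ?exprn_gt0 // mul1r -natrX ler_nat.
  exact: ltn_expl.
apply: c1_bound_le (lexx _) _ (c1_bound_poly _ _); last by rewrite invr_ge0.
  rewrite (_ : 2 * 2^-1 ^+ k =
      \sum_(i < size (elem_poly k N)) (elem_poly k N)`_i * 2^-1 ^+ k +
      \sum_(i < size (elem_poly k N)) (elem_poly k N)`_i * 2^-1 ^+ k); last first.
    by rewrite -!mulr_suml sum1 mul1r mulr_natl mulr2n.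
  rewrite horner_coef horner_deriv lerD //; apply: ler_sum => i _.
    by have [/ck ->|ki] := leqP i k; rewrite ?mul0r // ler_wpM2l ?le_half.
  by have [/ck ->|ki] := leqP i k; rewrite ?mul0r // ler_wpM2l ?le_deriv.
by apply/polyOverP => i; exact: c0.
Qed.

Definition elem_factor k u : R[i] := (1 - u) * cexp (toC (log_poly k)).[u].

Lemma elem_factor_bound k :
  c1_bound (fun u => elem_factor k u - 1) 4^-1 (2 * 2^-1 ^+ k).
Proof.
apply: (@c1_bound_ext _ (fun u => - (1 - elem_factor k u))); last first.
  by move=> u _; rewrite opprB.
apply: c1_boundN.
apply: (@c1_bound_lim _ (fun N u => (toC (elem_poly k N)).[u])); last first.
  by exists k => // N; exact: elem_poly_bound.
move=> u; apply/cvg_cabsP => e e0.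
have [/(_ (toC (log_poly k)).[u])/(@cvg_cabsMl _ _ _ (1 - u)) exp_lim _] :=
  cexp_limit R.
have /cvg_cabsP/(_ _ e0)[N _ near_exp] := exp_lim; exists N => // M NM.
have := near_exp _ (leq_trans NM (leqnSn M)).
rewrite /elem_poly /elem_factor !rmorphB rmorphM rmorphB /= rmorph1 map_polyX.
rewrite map_comp_poly !hornerE horner_comp => near_M.
rewrite -cabsN; congr (cabs _ < _): near_M; ring.
Qed.

Lemma entire_elem_factor k : entire (elem_factor k).
Proof.
have e1 : entire (fun u : R[i] => 1 + -1 * u).
  exact: (entireD (entire_cst 1) (entireM (entire_cst (-1)) (@entire_id R))).
have e2 := entire_comp (@entire_cexp R) (entire_horner (toC (log_poly k))).
have := entireM e1 e2; congr entire.
by apply/funext => u; rewrite /elem_factor mulN1r.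
Qed.

Lemma c1_bound_elem_factor k r : exists L, c1_bound (elem_factor k) r L.
Proof.
have [L bL] : exists L, c1_bound (fun u => (toC (log_poly k)).[u]) r L.
  eexists; apply: c1_bound_le (ler_norm r) (lexx _) _.
  exact: (c1_bound_poly (log_poly_nneg k) (normr_ge0 r)).
have [L' bL'] := c1_bound_cexp L.
have b1 := c1_boundD (@c1_bound_cst R 1 r) (c1_boundN (@c1_bound_id R r)).
by eexists; exact: (c1_boundM b1 (c1_bound_comp bL (lexx L) bL')).
Qed.

Lemma c1_bound_scale a r : 4 <= cabs a -> 4 * r <= cabs a ->
  c1_bound (fun z => z / a) r 4^-1.
Proof.
move=> a4 ra z w zr wr; have a0 : 0 < cabs a by rewrite (lt_le_trans _ a4).
rewrite -mulrBl !cabsM cabsV; split.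
  rewrite ler_pdivrMr // mulrC ler_pdivlMr // mulrC (le_trans _ ra) //.
  by rewrite ler_wpM2l.
by rewrite mulrC ler_wpM2r ?cabs_ge0 // lef_pV2 // posrE.
Qed.

Lemma elem_factor_scale_bound k a r : 4 <= cabs a -> 4 * r <= cabs a ->
  c1_bound (fun z => elem_factor k (z / a) - 1) r (2 * 2^-1 ^+ k).
Proof.
move=> a4 ra.
have := c1_bound_comp (c1_bound_scale a4 ra) (lexx _) (elem_factor_bound k).
by rewrite max_l ?mulr1 // invf_le1 ?ler1n.
Qed.

End ElementaryFactor.

Section InfiniteProduct.
Variable R : realType.
Implicit Types (z a : R[i]) (r e L : R) (k K N M : nat).
Implicit Types (H : nat -> R[i] -> R[i]).

Definition c1_summable_product H :=
  [/\ forall k, entire (H k), forall k r, exists L, c1_bound (H k) r L &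
    forall r, exists K, forall k, (K <= k)%N ->
      c1_bound (fun z => H k z - 1) r (2^-1 ^+ k)].

Lemma c1_summable_product_shift H K :
  c1_summable_product H -> c1_summable_product (fun k => H (K + k)%N).
Proof.
move=> [He Hb Hs]; split=> [k|k r|r]; [exact: He|exact: Hb|].
have [N Nb] := Hs r.
exists N => k Nk; apply: c1_bound_le (lexx _) _ (Nb _ _); last first.
  by rewrite (leq_trans Nk) // leq_addl.
by rewrite ler_wiXn2l ?invr_ge0 ?invf_le1 ?ler1n ?leq_addl.
Qed.

Lemma partial_product_bound H r : c1_summable_product H ->
  exists N, exists2 L, 0 <= L & forall k, (N <= k)%N ->
    c1_bound (fun z => \prod_(0 <= j < k) H j z) r L /\
    c1_bound (fun z => H k z - 1) r (2^-1 ^+ k).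
Proof.
move=> [_ Hb Hs]; have [K Kb] := Hs r; pose N := maxn K 3.
have prod_bound k : exists L, c1_bound (fun z => \prod_(0 <= j < k) H j z) r L.
  elim: k => [|k [L bL]].
    exists (cabs 1); apply: c1_bound_ext (@c1_bound_cst R 1 r) _ => z _.
    by rewrite big_geq.
  have [L' bL'] := Hb k r; eexists; apply: c1_bound_ext (c1_boundM bL bL') _.
  by move=> z _; rewrite big_nat_recr.
have [L bL] := prod_bound N; exists N, (`|L| * 2) => [|k Nk].
  by rewrite mulr_ge0.
split; last by apply: Kb; rewrite (leq_trans (leq_maxl K 3)).
suff : c1_bound (fun z => \prod_(0 <= j < k) H j z) r
    (`|L| * (2 - 8 * 2^-1 ^+ k)).
  apply: c1_bound_le => //; rewrite ler_wpM2l // lerBlDr lerDl.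
  by rewrite mulr_ge0 // exprn_ge0 // invr_ge0.
rewrite -(subnK Nk); elim: (k - N)%N => [|m IHm].
  apply: c1_bound_le (lexx _) _ bL; rewrite add0n (le_trans (ler_norm _)) //.
  rewrite ler_peMr // lerBrDr (_ : 2 = 1 + 1 :> R) // lerD2l.
  have : 2^-1 ^+ N <= 2^-1 ^+ 3 :> R.
    by rewrite ler_wiXn2l ?invr_ge0 ?invf_le1 ?ler1n ?leq_maxr.
  rewrite exprVn; lra.
have HmN : c1_bound (fun z => H (m + N)%N z - 1) r (2^-1 ^+ (m + N)).
  by apply: Kb; rewrite (leq_trans (leq_maxl K 3)) // leq_addl.
have d0 : 0 <= 2^-1 ^+ (m + N) :> R by rewrite exprn_ge0 // invr_ge0.
apply: (c1_bound_le (lexx r)); last first.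
  apply: c1_bound_ext (c1_boundD IHm (c1_boundM IHm HmN)) _ => z _ /=.
  by rewrite addSn big_nat_recr //= mulrBr mulr1 addrC subrK.
rewrite addSn exprS; set d := 2^-1 ^+ (m + N) in d0 *.
rewrite (_ : _ + _ = `|L| * ((2 - 8 * d) * (1 + 2 * d))); last by ring.
rewrite ler_wpM2l //; nra.
Qed.

Lemma infinite_product H : c1_summable_product H ->
  exists f, [/\ entire f,
    forall z, \prod_(0 <= j < k) H j z @[k --> \oo] --> (f z : R[i]^o) &
    forall r e, 0 < e -> exists N, forall M, (N <= M)%N ->
      c1_bound (fun z => f z - \prod_(0 <= j < M) H j z) r e].
Proof.
move=> Hs; have [He _ _] := Hs.
have prod_entire k : entire (fun z => \prod_(0 <= j < k) H j z).
  elim: k => [|k IHk].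
    have -> : (fun z => \prod_(0 <= j < 0) H j z) = fun=> 1.
      by apply/funext => z; rewrite big_geq.
    exact: (entire_cst 1).
  have -> : (fun z => \prod_(0 <= j < k.+1) H j z) =
      fun z => \prod_(0 <= j < k) H j z * H k z.
    by apply/funext => z; rewrite big_nat_recr.
  exact: (entireM IHk (He k)).
have [f [fl fu]] : exists f,
    (forall z, \prod_(0 <= j < k) H j z @[k --> \oo] --> (f z : R[i]^o)) /\
    forall r e, 0 < e -> exists N, forall M, (N <= M)%N ->
      c1_bound (fun z => f z - \prod_(0 <= j < M) H j z) r e.
  apply: (@c1_cauchy_lim R (fun k z => \prod_(0 <= j < k) H j z)) => r e e0.
  have [N [L L0 NL]] := partial_product_bound r Hs.
  have tail K m : (N <= K)%N ->
      c1_bound (fun z => \prod_(0 <= j < K + m) H j z -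
        \prod_(0 <= j < K) H j z) r
        (4 * L * (2^-1 ^+ K - 2^-1 ^+ (K + m))).
    move=> NK; elim: m => [|m IHm].
      rewrite addn0 subrr mulr0 -(cabs0 R).
      by apply: c1_bound_ext (@c1_bound_cst R 0 r) _ => z _; rewrite subrr.
    have [bP bH] := NL _ (leq_trans NK (leq_addr m K)).
    apply: (c1_bound_le (lexx r)); last first.
      apply: c1_bound_ext (c1_boundD IHm (c1_boundM bP bH)) _ => z _ /=.
      rewrite addnS big_nat_recr //=; ring.
    by rewrite addnS exprS; set d := _ ^+ (K + m); lra.
  have [K Ke] : exists K, 4 * L * 2^-1 ^+ K <= e.
    have L1 : 0 < 4 * L + 1 by rewrite ltr_wpDl ?mulr_ge0.
    have half1 : `|2^-1 : R| < 1 by rewrite ger0_norm ?invr_ge0 // invf_lt1 ?ltr1n.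
    have /cvgrPdist_lt/(_ _ (divr_gt0 e0 L1))[K _ /(_ K (leqnn K))] :=
      cvg_expr half1.
    rewrite sub0r normrN ger0_norm ?exprn_ge0 ?invr_ge0 // => dK; exists K.
    have d0 : 0 <= 2^-1 ^+ K :> R by rewrite exprn_ge0 // invr_ge0.
    move: dK; rewrite ltr_pdivlMr // mulrC => /ltW; apply: le_trans.
    by rewrite ler_wpM2r // lerDl.
  exists (maxn N K) => M NM.
  rewrite -(subnKC NM); apply: c1_bound_le (lexx _) _ (tail _ _ (leq_maxl _ _)).
  apply: le_trans Ke; rewrite ler_wpM2l ?mulr_ge0 // lerBlDr ler_wpDr //.
  by rewrite ler_wiXn2l ?invr_ge0 ?invf_le1 ?ler1n ?leq_maxr.
exists f; split; [|exact: fl|exact: fu].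
apply: (entire_c1_lim prod_entire) => r e e0.
by have [N fN] := fu r e e0; exists N; exact: fN.
Qed.

Lemma infinite_product_split H f K : c1_summable_product H ->
  (forall z, \prod_(0 <= j < k) H j z @[k --> \oo] --> (f z : R[i]^o)) ->
  exists2 g, entire g & forall z, f z = (\prod_(0 <= j < K) H j z) * g z.
Proof.
move=> Hs fl; have [g [ge gl _]] := infinite_product (c1_summable_product_shift K Hs).
exists g => // z.
have fgl := @cvg_cabsMl R _ _ (\prod_(0 <= j < K) H j z) (gl z).
apply: (cvg_unique (@norm_hausdorff _ R[i]^o)) fgl.
apply/cvg_cabsP => e e0; have /cvg_cabsP/(_ _ e0)[N _ near_f] := fl z.
exists N => // k Nk; have := near_f (K + k)%N (leq_trans Nk (leq_addl _ _)).
rewrite /= (big_cat_nat _ (leq_addr k K)) //=.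
suff -> : \prod_(K <= j < K + k) H j z = \prod_(0 <= j < k) H (K + j)%N z by [].
rewrite -{1}[K]add0n big_addn addKn; apply: eq_bigr => j _.
by rewrite addnC.
Qed.

End InfiniteProduct.

Section Enumeration.
Variables (R : realType) (S : set R[i]) (mu : R[i] -> nat).

Lemma enumerate_with_multiplicity :
  (forall N : nat, finite_set [set c | S c /\ cabs c <= N%:R]) ->
  ~ S 0 ->
  exists a : nat -> R[i], [/\ forall k, a k != 0,
    forall N : nat, exists m, forall k, (m <= k)%N -> N%:R <= cabs (a k) &
    forall c, S c -> exists K, (mu c <= count_mem c (mkseq a K))%N].
Proof.
move=> Sfin S0.
have /choice[s sP] : forall N : nat, exists s : seq R[i], forall c,
    c \in s <-> [/\ S c, N%:R <= cabs c & cabs c <= N.+1%:R].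
  move=> N.
  have [s sE] : exists s : seq R[i],
      [set c | [/\ S c, N%:R <= cabs c & cabs c <= N.+1%:R]] = [set` s].
    by apply/finite_seqP; apply: sub_finite_set (Sfin N.+1) => c [].
  exists s => c; have -> : c \in s = ([set` s] c) :> Prop by [].
  by rewrite -sE.
(* The head [N.+1] only serves to make every block nonempty. *)
pose block N := N.+1%:R :: flatten [seq nseq (mu c) c | c <- s N].
pose blocks n := flatten [seq block N | N <- iota 0 n].
have block_ge N c : c \in block N -> N%:R <= cabs c /\ c != 0.
  rewrite inE => /orP[/eqP ->|/flatten_mapP[b /sP[Sb Nb _]]].
    by rewrite cabs_nat ler_nat leqnSn pnatr_eq0.
  rewrite mem_nseq => /andP[_ /eqP ->]; split=> //.
  by apply/eqP => b0; apply: S0; rewrite -b0.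
have blocksD m n : blocks (m + n)%N = blocks m ++ flatten [seq block N | N <- iota m n].
  by rewrite /blocks iotaD map_cat flatten_cat.
have size_blocks n : (n <= size (blocks n))%N.
  elim: n => // n IHn; rewrite -addn1 blocksD size_cat /= cats0.
  by rewrite leq_add.
pose a k := nth 0 (blocks k.+1) k.
have aE n k : (k < size (blocks n))%N -> a k = nth 0 (blocks n) k.
  move=> kn; have [nk|kn'] := leqP n k.+1.
    by rewrite /a -(subnKC nk) blocksD nth_cat kn.
  by rewrite /a -(subnKC (ltnW kn')) blocksD nth_cat size_blocks.
have a_block m k : (size (blocks m) <= k)%N ->
    exists2 N, (m <= N)%N & a k \in block N.
  move=> mk; have mk1 : (m <= k.+1)%N.
    by rewrite (leq_trans (size_blocks m)) // (leq_trans mk).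
  pose rest := flatten [seq block N | N <- iota m (k.+1 - m)].
  have blocksE : blocks k.+1 = blocks m ++ rest by rewrite -blocksD subnKC.
  have lt_k : (k < size (blocks k.+1))%N := size_blocks k.+1.
  rewrite blocksE size_cat in lt_k.
  rewrite /a blocksE nth_cat ltnNge mk /=.
  have /flatten_mapP[N] : nth 0 rest (k - size (blocks m)) \in rest.
    by rewrite mem_nth // ltn_subLR.
  by rewrite mem_iota => /andP[mN _] ?; exists N.
exists a; split=> [k|N|c Sc].
- by have [] := a_block 0%N k isT => N _ /block_ge[].
- exists (size (blocks N)) => k /a_block[M NM /block_ge[Ma _]].
  by rewrite (le_trans _ Ma) // ler_nat.
pose N := Num.truncn (cabs c).
have cN : c \in s N.
  have /andP[Nc cN] := truncn_itv (cabs_ge0 c).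
  by apply/sP; split=> //; exact: ltW.
exists (size (blocks N.+1)).
have -> : mkseq a (size (blocks N.+1)) = blocks N.+1.
  apply: (@eq_from_nth _ 0); rewrite size_mkseq // => k kN.
  by rewrite nth_mkseq // (aE N.+1).
rewrite -addn1 blocksD /= cats0 count_cat (leq_trans _ (leq_addl _ _)) //=.
rewrite (leq_trans _ (leq_addl _ _)) // count_flatten -map_comp.
rewrite (perm_sumn (perm_map _ (perm_to_rem cN))) /= count_nseq /= eqxx mul1n.
exact: leq_addr.
Qed.

End Enumeration.

Section Discrete.
Variable R : realType.
Implicit Types (S : set R[i]) (a z : R[i]) (r : R).

Lemma discrete_finite S :
  (forall a, exists2 d : R, 0 < d &
    forall z, z != a -> cabs (z - a) < d -> ~ S z) ->
  forall r, finite_set [set c | S c /\ cabs c <= r].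
Proof.
move=> Sd r; pose f (p : R * R) := p.1 +i* p.2.
pose T := [set p : R * R | S (f p) /\ cabs (f p) <= r].
suff Tfin : finite_set T.
  apply: sub_finite_set (finite_image f Tfin) => -[x y] Tc.
  by exists (x, y).
apply: contrapT => Tinf.
(* A cluster point of the cofinite filter of [T] is an accumulation point. *)
pose F : set_system (R * R) := [set B | finite_set (T `\` B)].
have FF : ProperFilter F.
  apply: Build_ProperFilter_ex.
    move=> B FB; apply: contrapT => /forallNP B0; apply: Tinf.
    rewrite (_ : T = T `\` B) //; apply/seteqP; split=> [p Tp|p []//].
    by split=> //; exact: B0.
  split=> [|B B' FB FB'|B B' BB' FB].
  - by rewrite /F /= setDT.
  - by rewrite /F /= setDIr finite_setU.
  - by apply: sub_finite_set FB => p [Tp nB'p]; split=> // /BB'.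
have [p [_ clp]] : (`[- r, r] `*` `[- r, r]) `&` cluster F !=set0.
  apply: (compact_setX (@segment_compact _ _ _) (@segment_compact _ _ _)).
  rewrite /F /= (_ : T `\` _ = set0) //; apply/seteqP; split=> // -[x y] [[_ xyr]].
  apply; split; rewrite /= in_itv /= -ler_norml (le_trans _ xyr) //.
    exact: (Re_le_cabs (f (x, y))).
  exact: (Im_le_cabs (f (x, y))).
have [d d0 Sp] := Sd (f p).
have d20 : 0 < d / 2 by rewrite divr_gt0.
have Fp : F [set q | T q /\ q != p].
  apply: sub_finite_set (finite_set1 p) => q [Tq nq] /=.
  by apply: contrapT => /eqP qp; apply: nq.
have Up : nbhs p [set q : R * R | cabs (f q - f p) < d].
  exists (ball p.1 (d / 2), ball p.2 (d / 2)) => /=.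
    by split; exact: nbhsx_ballx.
  move=> [x y] [/= xp yp]; rewrite (le_lt_trans (cabs_le_ReIm _)) // (splitr d).
  by rewrite ltrD //= distrC.
have [q [[[Sq _] qp] qd]] := clp _ _ Fp Up.
apply: (Sp (f q)) => //; apply: contra qp => /eqP[].
by case: q p {clp Sp Fp Up Sq qd} => [x y] [x' y'] /= -> ->.
Qed.

End Discrete.

Section WeierstrassProduct.
Variable R : realType.
Implicit Types (S : set R[i]) (a : nat -> R[i]) (c z u : R[i]) (r e : R).

Lemma entire_scale c : entire (fun z => z / c).
Proof. exact: (entireM (@entire_id R) (entire_cst c^-1)). Qed.

Lemma elem_factor_root k c : c != 0 -> exists2 g, entire g &
  forall z, elem_factor k (z / c) = (z - c) * g z.
Proof.
move=> c0; pose h u := cexp ((map_poly (real_complex R) (log_poly R k)).[u]).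
have he : entire h by exact: (entire_comp (@entire_cexp R) (entire_horner _)).
exists (fun z => - c^-1 * h (z / c)).
  exact: (entireM (entire_cst (- c^-1)) (entire_comp he (entire_scale c))).
by move=> z; rewrite /elem_factor -/(h _); field.
Qed.

Lemma elem_product_root a c K : (forall k, a k != 0) -> exists2 g, entire g &
  forall z, \prod_(0 <= j < K) elem_factor j.+1 (z / a j) =
    (z - c) ^+ count_mem c (mkseq a K) * g z.
Proof.
move=> a0; elim: K => [|K [g ge gE]].
  by exists (fun=> 1) => [|z]; [exact: (entire_cst 1)|rewrite big_geq ?mulr1].
rewrite mkseqS -cats1 count_cat /=.
have [ac|ac] := eqVneq (a K) c.
  have [h he hE] := elem_factor_root K.+1 (a0 K).
  exists (fun z => g z * h z) => [|z]; first exact: (entireM ge he).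
  by rewrite big_nat_recr //= gE hE ac addn0 addn1 exprSr; ring.
exists (fun z => g z * elem_factor K.+1 (z / a K)) => [|z].
  exact: (entireM ge (entire_comp (@entire_elem_factor R K.+1) (entire_scale (a K)))).
by rewrite big_nat_recr //= gE !addn0 mulrA.
Qed.

Lemma c1_summable_elem_factor a : (forall k, a k != 0) ->
  (forall N : nat, exists m, forall k, (m <= k)%N -> N%:R <= cabs (a k)) ->
  c1_summable_product (fun k z => elem_factor k.+1 (z / a k)).
Proof.
move=> a0 a_oo; split=> [k|k r|r].
- exact: (entire_comp (@entire_elem_factor R k.+1) (entire_scale (a k))).
- have [L bL] : exists L, c1_bound (fun z => z / a k) r L.
    by eexists; exact: (c1_boundM (@c1_bound_id R r) (@c1_bound_cst R (a k)^-1 r)).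
  have [L' bL'] := c1_bound_elem_factor k.+1 L.
  by eexists; exact: (c1_bound_comp bL (lexx L) bL').
have [m am] := a_oo (maxn 4 (Num.truncn `|4 * r|).+1); exists m => k mk.
have := am _ mk; rewrite natr_max ge_max => /andP[a4 ar].
apply: c1_bound_le (lexx _) _ (elem_factor_scale_bound k.+1 a4 _).
  by rewrite exprS mulrA divff ?mul1r ?pnatr_eq0.
rewrite (le_trans _ ar) // (le_trans (ler_norm _)) // ltW //.
exact: truncnS_gt.
Qed.

Lemma weierstrass_product S (mu : R[i] -> nat) :
  (forall N : nat, finite_set [set c | S c /\ cabs c <= N%:R]) -> ~ S 0 ->
  exists a f, [/\ forall k, a k != 0, cabs (a k) @[k --> \oo] --> +oo,
    entire f,
    forall r e, 0 < e -> exists N, forall M, (N <= M)%N -> forall z,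
      cabs z <= r ->
      cabs (f z - \prod_(0 <= j < M) elem_factor j.+1 (z / a j)) <= e &
    forall c, S c -> exists2 g, entire g &
      forall z, f z = (z - c) ^+ mu c * g z].
Proof.
move=> Sfin S0.
have [a [a0 a_oo a_mu]] := enumerate_with_multiplicity mu Sfin S0.
have Hs := c1_summable_elem_factor a0 a_oo.
have [f [fe fl fu]] := infinite_product Hs.
exists a, f; split; [exact: a0| |exact: fe| |].
- apply/cvgryPge => A; have [m am] := a_oo (Num.truncn `|A|).+1.
  exists m => // k /am; apply: le_trans.
  by rewrite (le_trans (ler_norm _)) // ltW // truncnS_gt.
- move=> r e e0; have [N fN] := fu r e e0; exists N => M NM z zr.
  by have [] := fN M NM z z zr zr.
move=> c Sc; have [K Kmu] := a_mu c Sc.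
have [g ge fg] := infinite_product_split K Hs fl.
have [h he hE] := elem_product_root c K a0.
exists (fun z => (z - c) ^+ (count_mem c (mkseq a K) - mu c) * h z * g z).
  have ce : entire (fun z => z - c).
    exact: (entireD (@entire_id R) (entire_cst (- c))).
  exact: (entireM (entireM (entireX _ ce) he) ge).
by move=> z; rewrite fg hE !mulrA -exprD subnKC.
Qed.

End WeierstrassProduct.

Section CanonicalProduct.
Variables (R : realType) (n : nat).
Implicit Types (c z : R[i]) (e : R).

Lemma scalar_mx_exp c k : (c%:M : 'M[R[i]]_n) ^+ k = (c ^+ k)%:M.
Proof. by elim: k => // k IHk; rewrite !exprS IHk scalar_mxM. Qed.

Lemma mx_exp_scalar c : mx_exp (c%:M : 'M[R[i]]_n) = (cexp c)%:M.
Proof.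
apply: (cvg_lim (@norm_hausdorff _ 'M[R[i]^o]_n)).
have -> : (fun N => \sum_(0 <= k < N) k`!%:R^-1 *: (c%:M : 'M[R[i]]_n) ^+ k) =
    fun N => (map_poly (real_complex R) (exp_poly R N)).[c] *: 1%:M.
  apply/funext => N; rewrite /exp_poly rmorph_sum horner_sum scaler_suml.
  apply: eq_bigr => k _; rewrite /= map_polyZ map_polyXn hornerZ hornerXn.
  by rewrite scalar_mx_exp fmorphV rmorph_nat -scalerA scalemx1.
apply/cvg_ballP => _ /gt0_real_complex[e e0 ->].
have /cvg_cabsP/(_ _ e0) := (cexp_limit R).1 c; apply: filterS => N cN.
split=> [|i j]; first by rewrite ltcR.
rewrite !mxE mulr_natr -ball_normE /= -mulrnBl normrMn cabsE cabsB.
have [_|_] := eqVneq i j; first by rewrite mulr1n ltcR.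
by rewrite mulr0n ltcR.
Qed.

Lemma op_norm_scalar_le c : op_norm (c%:M : 'M[R[i]]_n) <= cabs c.
Proof.
apply: ge_sup => [|_ [x /= x1 <-]].
  exists (vec_norm ((c%:M : 'M[R[i]]_n) *m 0)); exists 0 => //=.
  rewrite /vec_norm big1 ?sqrtr0 // => i _; rewrite mxE cabs0 expr0n.
  by [].
rewrite mul_scalar_mx; suff -> : vec_norm (c *: x) = cabs c * vec_norm x.
  by rewrite ler_piMr // cabs_ge0.
rewrite /vec_norm -[cabs c]ger0_norm ?cabs_ge0 // -sqrtr_sqr -sqrtrM ?sqr_ge0 //.
by congr Num.sqrt; rewrite mulr_sumr; apply: eq_bigr => i _; rewrite mxE cabsM exprMn.
Qed.

Lemma canonical_factor_scalar k c z :
  canonical_factor k (1%:M : 'M[R[i]]_n) c z = (elem_factor k (z / c))%:M.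
Proof.
rewrite /canonical_factor /elem_factor.
have -> : \sum_(1 <= l < k.+1) (l%:R^-1 * (z ^+ l / c ^+ l)) *: (1%:M : 'M[R[i]]_n)
    = ((map_poly (real_complex R) (log_poly R k)).[z / c])%:M.
  rewrite /log_poly rmorph_sum horner_sum -scaler_suml scalemx1; congr _%:M.
  apply: eq_bigr => l _; rewrite /= map_polyZ map_polyXn hornerZ hornerXn.
  by rewrite fmorphV rmorph_nat expr_div_n.
by rewrite mx_exp_scalar scalemx1 -raddfB -scalar_mxM mulrC.
Qed.

Lemma canonical_partial_product_scalar (a : nat -> R[i]) k z :
  canonical_partial_product (fun=> 1%:M : 'M[R[i]]_n) (fun k => a k.-1) k z =
  (\prod_(0 <= j < k) elem_factor j.+1 (z / a j))%:M.
Proof.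
elim: k => [|k IHk]; first by rewrite big_geq.
by rewrite big_nat_recr //= IHk canonical_factor_scalar -scalar_mxM mulrC.
Qed.

End CanonicalProduct.

Section Meromorphic.
Variable R : realType.
Implicit Types (f g h : R[i] -> R[i]) (a c z : R[i]) (m : nat).

Lemma holomorphic_at_ball f a (d : R) : 0 < d ->
  (forall z, cabs (z - a) < d -> derivable (f : R[i]^o -> R[i]^o) z 1) ->
  forall z, cabs (z - a) < d -> holomorphic_at f z.
Proof.
move=> d0 fd z zd; apply/nbhs_cabsP; exists (d - cabs (z - a)).
  by rewrite subr_gt0.
move=> w; rewrite ltrBrDr => wz; apply: fd; apply: le_lt_trans wz.
by rewrite -(subrKA z) ler_cabsD.
Qed.

Lemma holomorphic_at_near f a : holomorphic_at f a ->
  exists2 d : R, 0 < d & forall z, cabs (z - a) < d -> holomorphic_at f z.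
Proof.
by move=> /nbhs_cabsP[d d0 fd]; exists d => // z zd; exact: holomorphic_at_ball fd z zd.
Qed.

Lemma holomorphic_at_eq f g a (d : R) : 0 < d ->
  (forall z, cabs (z - a) < d -> f z = g z) ->
  holomorphic_at f a -> holomorphic_at g a.
Proof.
move=> d0 fg /nbhs_cabsP[d' d'0 fd]; apply/nbhs_cabsP.
exists (Num.min d d'); first by rewrite lt_min d0.
move=> z; rewrite lt_min => /andP[zd zd'].
apply: near_eq_derivable (fd z zd'); apply/nbhs_cabsP.
exists (d - cabs (z - a)); first by rewrite subr_gt0.
move=> w; rewrite ltrBrDr => wz; apply: fg; apply: le_lt_trans wz.
by rewrite -(subrKA z) ler_cabsD.
Qed.

Lemma subr_neq0 a z : z != a -> z - a != 0.
Proof. by rewrite subr_eq0. Qed.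

Lemma mulf_cancel_expr (x u v : R[i]) m : x != 0 ->
  x ^+ m * u * (v / x ^+ m) = u * v.
Proof. by move=> /(expf_neq0 m) x0; field. Qed.

Definition pole_order_le f a m := exists2 g, holomorphic_at g a &
  \forall z \near (a : R[i]^o)^', f z = g z / (z - a) ^+ m.

Lemma entire_subX c m : entire (fun z => (z - c) ^+ m).
Proof.
exact: (entireX m (entireD (@entire_id R) (entire_cst (- c)))).
Qed.

Lemma meromorphic_pole_order f a : meromorphic f -> exists m, pole_order_le f a m.
Proof.
move=> /(_ a)[fa|[m [g [_ ga _ fg]]]]; last by exists m, g.
exists 0%N, f => //; apply/dnbhs_cabsP; exists 1 => // z _ _.
by rewrite expr0 divr1.
Qed.

Lemma pole_order_leW f a m m' : (m <= m')%N ->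
  pole_order_le f a m -> pole_order_le f a m'.
Proof.
move=> mm' [g ga /dnbhs_cabsP[d d0 fg]].
exists (fun z => g z * (z - a) ^+ (m' - m)).
  exact: (holomorphic_atM ga (entire_subX a (m' - m) a)).
apply/dnbhs_cabsP; exists d => // z za zd; rewrite fg //.
have za0 : z - a != 0 by rewrite subr_eq0.
rewrite -{2}(subnKC mm') exprD invfM mulrA [g z * _ / _]mulrAC -[LHS]mulr1.
by rewrite -[RHS]mulrA divff ?expf_neq0.
Qed.

Lemma pole_order_le_holomorphic f a m : pole_order_le f a m ->
  exists2 d : R, 0 < d &
    forall z, z != a -> cabs (z - a) < d -> holomorphic_at f z.
Proof.
move=> [g /holomorphic_at_near[d d0 gd] /dnbhs_cabsP[d' d'0 fg]].
exists (Num.min d d') => [|z za]; first by rewrite lt_min d0.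
rewrite lt_min => /andP[zd zd'].
have za0 : 0 < cabs (z - a) by rewrite cabs_gt0 subr_eq0.
have d''0 : 0 < Num.min (cabs (z - a)) (d' - cabs (z - a)).
  by rewrite lt_min za0 subr_gt0.
have near_ne w : cabs (w - z) < cabs (z - a) -> w != a.
  by apply: contraTN => /eqP ->; rewrite cabsB ltxx.
apply: (@holomorphic_at_eq (fun w => g w * ((w - a) ^+ m)^-1) f z _ d''0).
  move=> w; rewrite lt_min ltrBrDr => /andP[wz wd]; rewrite fg ?near_ne //.
  by apply: le_lt_trans wd; rewrite -(subrKA z) ler_cabsD.
apply: holomorphic_atM; first exact: gd.
apply/nbhs_cabsP; exists (cabs (z - a)) => // w /near_ne wa.
have wa0 : (w - a) ^+ m != 0 by rewrite expf_neq0 // subr_eq0.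
exact: (derivableV wa0 ((entireP _).1 (entire_subX a m) w)).
Qed.

Lemma entire_extension (S : set R[i]) h :
  (forall a, ~ S a -> holomorphic_at h a /\ \forall z \near (a : R[i]^o), ~ S z) ->
  (forall a, S a -> exists2 k, holomorphic_at k a &
    \forall z \near (a : R[i]^o)^', ~ S z /\ h z = k z) ->
  exists2 g, entire g & forall z, ~ S z -> g z = h z.
Proof.
move=> hreg hsing.
have /choice[k kP] : forall a, exists k, S a -> holomorphic_at k a /\
    \forall z \near (a : R[i]^o)^', ~ S z /\ h z = k z.
  move=> a; have [/hsing[k ka hk]|nSa] := pselect (S a); first by exists k.
  by exists h.
pose g z := if `[< S z >] then k z z else h z.
have gE z : ~ S z -> g z = h z by move=> nSz; rewrite /g asboolF.
exists g => [a|//].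
have [Sa|nSa] := pselect (S a); last first.
  have [ha /nbhs_cabsP[d d0 nS]] := hreg a nSa.
  by apply: (holomorphic_at_eq d0 _ ha) => z zd; rewrite gE //; exact: nS.
have [ka /dnbhs_cabsP[d d0 hk]] := kP a Sa.
apply: (holomorphic_at_eq d0 _ ka) => z zd.
have [->|za] := eqVneq z a; first by rewrite /g asboolT.
by have [nSz hkz] := hk z za zd; rewrite gE.
Qed.

Lemma mx_meromorphic_pole_order (n : nat) (F : R[i] -> 'M[R[i]]_n) :
  mx_meromorphic F -> exists mu : R[i] -> nat, forall a i j,
    pole_order_le (fun z => F z i j) a (mu a).
Proof.
move=> F_mero.
suff /choice[mu muP] : forall a, exists m, forall i j,
  pole_order_le (fun z => F z i j) a m by exists mu.
move=> a.
have /choice[m mP] : forall ij : 'I_n * 'I_n, exists m,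
    pole_order_le (fun z => F z ij.1 ij.2) a m.
  by move=> ij; exact: meromorphic_pole_order (F_mero ij.1 ij.2).
exists (\max_ij m ij)%N => i j.
exact: pole_order_leW (leq_bigmax (i, j)) (mP (i, j)).
Qed.

Lemma mx_holomorphic_at_dnear (n : nat) (F : R[i] -> 'M[R[i]]_n) a :
  mx_meromorphic F -> exists2 d : R, 0 < d &
    forall z, z != a -> cabs (z - a) < d -> mx_holomorphic_at F z.
Proof.
move=> /mx_meromorphic_pole_order[mu muP].
suff : \forall z \near (a : R[i]^o)^', forall ij : 'I_n * 'I_n,
    holomorphic_at (fun z => F z ij.1 ij.2) z.
  move=> /dnbhs_cabsP[d d0 Fd]; exists d => // z za zd i j.
  exact: (Fd z za zd (i, j)).
apply: filter_forall => ij; apply/dnbhs_cabsP.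
exact: pole_order_le_holomorphic (muP a ij.1 ij.2).
Qed.

Lemma mx_holomorphic_at_near (n : nat) (F : R[i] -> 'M[R[i]]_n) a :
  mx_meromorphic F -> mx_holomorphic_at F a ->
  \forall z \near (a : R[i]^o), mx_holomorphic_at F z.
Proof.
move=> /(mx_holomorphic_at_dnear a)[d d0 Fd] Fa; apply/nbhs_cabsP.
exists d; first exact: d0.
move=> z zd; have [->|za] := eqVneq z a; first exact: Fa.
exact: (Fd z za zd).
Qed.

End Meromorphic.

Theorem theorem4p2 (R : realType) (n : nat) (F : R[i] -> 'M[R[i]]_n)
    (F_mero : mx_meromorphic F)
    (F_hol0 : mx_holomorphic_at F 0)
    (F_det0 : \det (F 0) != 0) :
  exists P G : R[i] -> 'M[R[i]]_n,
    [/\ canonical_product_form P,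
        mx_entire G &
        forall z, mx_holomorphic_at F z -> G z = P z *m F z].
Proof.
pose S : set R[i] := [set c | ~ mx_holomorphic_at F c].
have S0 : ~ S 0 by move=> S0; exact: (S0 F_hol0).
have S_discrete a : exists2 d : R, 0 < d &
    forall z, z != a -> cabs (z - a) < d -> ~ S z.
  have [d d0 Fd] := mx_holomorphic_at_dnear a F_mero.
  exists d; first exact: d0.
  move=> z za zd Sz; exact: (Sz (Fd z za zd)).
have [mu muP] := mx_meromorphic_pole_order F_mero.
have [a [f [a0 a_oo fe fu f_root]]] :=
  weierstrass_product mu (fun N => discrete_finite S_discrete N%:R) S0.
have /choice[g gP] : forall ij : 'I_n * 'I_n, exists g : R[i] -> R[i], entire g /\
    forall z, mx_holomorphic_at F z -> g z = f z * F z ij.1 ij.2.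
  move=> [i j] /=; have [|c Sc|g ge gE] :=
    @entire_extension R S (fun z => f z * F z i j).
  - move=> c /contrapT Fc; split; first exact: (holomorphic_atM (fe c) (Fc i j)).
    have /nbhs_cabsP[d d0 Fd] := mx_holomorphic_at_near F_mero Fc.
    apply/nbhs_cabsP; exists d; first exact: d0.
    move=> z /Fd Fz Sz; exact: (Sz Fz).
  - have [h he fh] := f_root c Sc.
    have [k kc /dnbhs_cabsP[d d0 Fk]] := muP c i j.
    have [d' d'0 nS] := S_discrete c.
    exists (fun z => h z * k z); first exact: (holomorphic_atM (he c) kc).
    apply/dnbhs_cabsP; exists (Num.min d d'); first by rewrite lt_min d0.
    move=> z zc; rewrite lt_min => /andP[zd zd']; split; first exact: nS.
    rewrite fh (Fk z zc zd).
    exact: mulf_cancel_expr (subr_neq0 zc).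
  by exists g; split=> [|z Fz]; [exact: ge|apply: gE => Sz; exact: (Sz Fz)].
exists (fun z => (f z)%:M), (fun z => \matrix_(i, j) g (i, j) z); split.
- split=> [i j|].
    have [<-|ij] := eqVneq i j.
      have -> : (fun z => (f z)%:M i i : R[i]) = f.
        by apply/funext => z; rewrite mxE eqxx.
      exact: fe.
    have -> : (fun z => (f z)%:M i j : R[i]) = fun=> 0.
      by apply/funext => z; rewrite mxE (negbTE ij).
    exact: (entire_cst 0).
  exists (fun=> 1%:M), (fun k => a k.-1); split.
  + by move=> k _; split; [rewrite mul1mx|rewrite trmx1 map_mx1].
  + by move=> k _; exact: a0.
  + apply/cvgryPge => A; have /cvgryPge/(_ A)[m _ am] := a_oo.
    by exists m.+1 => // -[//|k] /= mk; exact: am.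
  move=> B [M [Mreal BM]] e e0.
  have e20 : 0 < e / 2 by rewrite divr_gt0.
  have [N fN] := fu (complex.Re M + 1) _ e20; exists N => // k Nk z Bz.
  rewrite canonical_partial_product_scalar -raddfB.
  rewrite (le_lt_trans (op_norm_scalar_le _ _)) //.
  apply: (@le_lt_trans _ _ (e / 2)).
    apply: (fN k Nk z); have := BM (M + 1); rewrite ltrDl ltr01.
    move=> /(_ isT z Bz) /=; rewrite cabsE -[M]RRe_real //.
    by rewrite -(rmorph1 (real_complex R)) -rmorphD /= lecR.
  by rewrite ltr_pdivrMr // ltr_pMr // ltr1n.
- move=> i j; have -> : (fun z => (\matrix_(i, j) g (i, j) z) i j) = g (i, j).
    by apply/funext => z; rewrite mxE.
  by have [ge _] := gP (i, j); exact: ge.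
move=> z Fz; apply/matrixP => i j.
by rewrite mul_scalar_mx !mxE; have [_ /(_ z Fz)] := gP (i, j).
Qed.
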